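(* For $\theta^*\in\Theta=\mathbb{R}^p$ let $P_{\theta^*}=\mathcal{N}(\theta^*,I_p)$, and consider data $X_1,\dots,X_n\stackrel{i.i.d.}{\sim}P$ where $W(P,P_{\theta^*})\le\epsilon$. There exist constants $C,c>0$ such that $$\inf_{\widehat\theta}\sup_{\theta^*\in\Theta,\;P:W(P_{\theta^*},P)\le\epsilon}\mathbb{P}\left(\|\theta^*-\widehat\theta\|_2\ge C\left(\sqrt{\frac pn}\vee\epsilon\right)\right)\ge c,$$ the infimum being over all estimators $\widehat\theta$ based on $X_1,\dots,X_n$.
   Context: $W$ is the Wasserstein-1 distance $W(P,Q)=\inf_\Pi\mathbb{E}_\Pi\|X-Y\|_2$ over couplings. $a\vee b=\max(a,b)$. *)

(* Defs.v *)
From HB Require Import structures.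
From mathcomp Require Import all_boot all_order all_algebra.
From mathcomp Require Import all_classical all_reals all_analysis.
Set Implicit Arguments. Unset Strict Implicit. Unset Printing Implicit Defensive.
Import Order.TTheory GRing.Theory Num.Theory.
Local Open Scope classical_set_scope.
Local Open Scope ring_scope.

(* Points of R^p are represented by p.-tuple R, which carries the product
   (Borel) sigma-algebra generated by the coordinate projections. *)

Definition l2dist {R : realType} {p : nat} (x y : p.-tuple R) : R :=
  Num.sqrt (\sum_(i < p) (tnth x i - tnth y i) ^+ 2).

(* mu is the p-dimensional Gaussian N(theta, I_p), i.e. the product measure
   of the one-dimensional N(theta_i, 1): its value on every measurable
   rectangle is the product of the marginal normal probabilities. *)
Definition is_gaussian_Ip {R : realType} {p : nat} (theta : p.-tuple R)
    (mu : probability (p.-tuple R) R) : Prop :=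
  forall A : 'I_p -> set R, (forall i, measurable (A i)) ->
    mu [set x | forall i, A i (tnth x i)] =
    ((\prod_(i < p) fine (normal_prob (tnth theta i) 1 (A i)))%:E).

Definition is_iid_law {R : realType} {p n : nat}
    (P : probability (p.-tuple R) R)
    (Q : probability (n.-tuple (p.-tuple R)) R) : Prop :=
  forall B : 'I_n -> set (p.-tuple R), (forall j, measurable (B j)) ->
    Q [set x | forall j, B j (tnth x j)] =
    ((\prod_(j < n) fine (P (B j)))%:E).

Definition is_coupling {R : realType} {p : nat}
    (P Q : probability (p.-tuple R) R)
    (pi : probability (p.-tuple R * p.-tuple R)%type R) : Prop :=
  (forall A, measurable A -> pi (A `*` setT) = P A) /\
  (forall A, measurable A -> pi (setT `*` A) = Q A).

Definition wasserstein1 {R : realType} {p : nat}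
    (P Q : probability (p.-tuple R) R) : \bar R :=
  ereal_inf [set e | exists pi, is_coupling P Q pi /\
     e = (\int[pi]_z (l2dist z.1 z.2)%:E)%E].

(* Main.v *)
(* Let m = max(sqrt(p/n), eps). If m = eps, the data law N(0, I)^n is compatible
   both with theta = eps e_1 and with theta = - eps e_1, since a translation by v
   moves N(0, I) by at most ||v|| in W_1; no estimate is at distance less than eps
   from both.

   If m = sqrt(p/n), take P = P_theta with theta in delta {-1, 1}^p and
   delta = 1 / (4 sqrt n). Flipping one sign changes the law of the sample so
   little that from the data one gets each sign wrong with probability at least
   1/3 on average over the cube; a reverse Markov inequality for the number of
   wrong coordinates gives a vertex at which ||theta - est|| >= sqrt(p/n) / 10
   has probability at least 1/6.

   Laws are compared without densities on the product space: the inequality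
   (int f dnu)^2 <= M int f^2 dmu for all f >= 0 tensorizes, with multiplication
   of the constants M, by Tonelli's theorem, and holds with M = exp((a - b)^2)
   for N(a, 1) and N(b, 1). *)
Require Import Defs.
From HB Require Import structures.
From mathcomp Require Import all_boot all_order all_algebra.
From mathcomp Require Import all_classical all_reals all_analysis.
From mathcomp Require Import measurable_realfun ring lra.
Set Implicit Arguments. Unset Strict Implicit. Unset Printing Implicit Defensive.
Import Order.TTheory GRing.Theory Num.Theory.
Local Open Scope classical_set_scope.
Local Open Scope ring_scope.

(** * Translation of the Lebesgue measure and of normal laws *)

Lemma lebesgue_measure_shift (R : realType) (a : R) (A : set R) :
  measurable A ->
  pushforward lebesgue_measure (fun x : measurableTypeR R => x + a) A =
  lebesgue_measure A :> \bar R.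
Proof.
have ma : measurable_fun [set: measurableTypeR R]
  (fun x : measurableTypeR R => x + a : measurableTypeR R).
  exact: measurable_funD.
move=> mA; apply/esym.
pose mfa : {mfun measurableTypeR R >-> measurableTypeR R} :=
  HB.pack (fun x : measurableTypeR R => x + a : measurableTypeR R)
    (isMeasurableFun.Build _ _ _ _ _ ma).
apply: (@lebesgue_measure_unique R
  (pushforward lebesgue_measure mfa)) => //= _ [[x y]] _ <-.
rewrite /pushforward (_ : _ @^-1` _ = `]x - a, y - a]%classic); last first.
  by apply/seteqP; split=> z /=; rewrite !in_itv/= ltrBlDr lerBrDr.
rewrite !lebesgue_measure_itv/= !lte_fin ltrD2r.
by case: ifP => // _; congr EFin; ring.
Qed.

Lemma normal_prob_shift (R : realType) (m a : R) (A : set R) :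
  measurable A ->
  normal_prob (m + a) 1 A = normal_prob m 1 ((fun x => x + a) @^-1` A) :> \bar R.
Proof.
move=> mA; rewrite /normal_prob.
have ma : measurable_fun [set: measurableTypeR R]
  (fun x : measurableTypeR R => x + a : measurableTypeR R).
  exact: measurable_funD.
pose mfa : {mfun measurableTypeR R >-> measurableTypeR R} :=
  HB.pack (fun x : measurableTypeR R => x + a : measurableTypeR R)
    (isMeasurableFun.Build _ _ _ _ _ ma).
transitivity (\int[pushforward lebesgue_measure mfa]_(x in A)
  (normal_pdf (m + a) 1 x)%:E)%E.
  apply: eq_measure_integral => B mB _; apply/esym.
  exact: lebesgue_measure_shift.
rewrite ge0_integral_pushforward; [|exact: ma|exact: mA| |].
2: apply/measurable_EFinP; apply: measurable_funTS; exact: measurable_normal_pdf.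
2: by move=> x _; rewrite lee_fin normal_pdf_ge0.
apply: eq_integral => x _ /=; congr EFin.
rewrite !normal_pdfE ?oner_eq0// /normal_fun.
by have -> : x + a - (m + a) = x - m by ring.
Qed.

(** * Integration against a measure given by a density *)

Section density.
Import HBNNSimple.

(** Monotone convergence along the approximations [f_ n] reduces to simple functions, and linearity
    to indicators, where the identity is the assumption on [nu]. *)
Lemma ge0_integral_density d (T : measurableType d) (R : realType)
    (mu nu : {measure set T -> \bar R}) (g : T -> R) (f : T -> \bar R) :
  measurable_fun setT g -> (forall x, 0 <= g x) ->
  (forall A, measurable A -> nu A = \int[mu]_(x in A) (g x)%:E)%E ->
  measurable_fun setT f -> (forall x, 0 <= f x)%E ->
  (\int[nu]_x f x = \int[mu]_x (f x * (g x)%:E))%E.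
Proof.
move=> mg g0 nug mf f0.
pose f_ := nnsfun_approx measurableT mf.
have mEg : measurable_fun setT (EFin \o g) by exact/measurable_EFinP.
have f_g n :
  measurable_fun setT (fun x => ((f_ n x)%:E * (g x)%:E)%E).
  by apply: emeasurable_funM => //; exact/measurable_EFinP.
transitivity (limn (fun n => \int[nu]_x (f_ n x)%:E))%E.
  rewrite -monotone_convergence//=.
  - apply: eq_integral => x _; apply/esym/cvg_lim => //=.
    exact: cvg_nnsfun_approx.
  - by move=> n; exact/measurable_EFinP.
  - by move=> n x _; rewrite lee_fin.
  - by move=> x _ m n mn; rewrite lee_fin; exact/lefP/nd_nnsfun_approx.
transitivity (limn (fun n => \int[mu]_x ((f_ n x)%:E * (g x)%:E)))%E; last first.
  rewrite -monotone_convergence//=.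
  - apply: eq_integral => x _; apply/cvg_lim => //=.
    apply: cvgeZr => //; exact: cvg_nnsfun_approx.
  - by move=> n x _; rewrite mule_ge0 ?lee_fin.
  - move=> x _ m n mn; rewrite lee_wpmul2r ?lee_fin//.
    exact/lefP/nd_nnsfun_approx.
apply: congr_lim; apply/funext => n.
under [LHS]eq_integral do rewrite fimfunE -fsumEFin//.
rewrite [LHS]ge0_integral_fsum//; last 2 first.
  - by move=> r; exact/measurable_EFinP/measurableT_comp.
  - by move=> k x _; rewrite EFinM nnfun_muleindic_ge0.
under [RHS]eq_integral.
  move=> x xD; rewrite fimfunE -fsumEFin// ge0_mule_fsuml; last first.
    by move=> r; rewrite EFinM nnfun_muleindic_ge0.
  over.
rewrite [RHS]ge0_integral_fsum//; last 2 first.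
  - move=> r; apply: emeasurable_funM => //.
    by apply/measurable_EFinP; do 2 apply/measurableT_comp => //.
  - by move=> k x _; rewrite EFinM mule_ge0 ?nnfun_muleindic_ge0 ?lee_fin.
apply: eq_fsbigr => r rf.
have r0 : (0 <= r)%R by move: rf; rewrite inE => -[x _ <-].
under eq_integral do rewrite EFinM.
have m1 : measurable_fun setT
    (fun x => (\1_(f_ n @^-1` [set r]) x)%:E : \bar R).
  by apply: measurableT_comp => //; exact: measurable_indic.
rewrite ge0_integralZl//.
under [RHS]eq_integral do rewrite EFinM -muleA.
rewrite ge0_integralZl//; last 2 first.
- exact: emeasurable_funM.
- by move=> x _; rewrite mule_ge0 ?lee_fin.
congr (_ * _)%E.
rewrite integral_indic// setIT nug// [LHS]integral_mkcond.
apply: eq_integral => x _; rewrite patchE indicE.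
by case: ifPn => _; rewrite ?mul1e ?mul0e.
Qed.

End density.

(** * Second-moment comparison of measures *)

(* When [nu << mu], the least such [M] is the second moment of [dnu/dmu] under
   [mu], that is, 1 plus the chi-square divergence. *)
Definition l2_dom {d} {T : measurableType d} {R : realType} (M : R)
    (nu mu : {measure set T -> \bar R}) : Prop :=
  forall f : T -> \bar R, measurable_fun setT f -> (forall x, 0 <= f x)%E ->
  (\int[nu]_x f x * \int[nu]_x f x <= M%:E * \int[mu]_x (f x * f x))%E.

(** Optimizing an AM-GM bound over its parameter recovers Cauchy-Schwarz, with no square root of an
    extended real. *)
Lemma sqr_le_of_amgm (R : realType) (M : R) (A S : \bar R) :
  0 < M -> (0 <= A)%E -> (0 <= S)%E ->
  (forall l : R, (0 < l)%R -> A <= (l * M)%:E + ((l *+ 4)^-1)%:E * S)%E ->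
  (A * A <= M%:E * S)%E.
Proof.
move=> M0 A0 S0 AS; case: S S0 AS => [s| |]//; last first.
  by move=> _ _; rewrite gt0_muley ?lte_fin// leey.
rewrite lee_fin => s0 AS.
case: A A0 AS => [a| |]// => [|_ /(_ _ ltr01)]; last first.
  by rewrite -EFinM -EFinD leye_eq.
(* For [a > 0] take [l = a / 2M]: the bound becomes [a <= a / 2 + M s / (2 a)], that is
   [a ^ 2 <= M s]. *)
rewrite lee_fin le_eqVlt => /predU1P[<- _|a0 /(_ (a / (M *+ 2)))].
  by rewrite -!EFinM lee_fin mul0r mulr_ge0// ltW.
rewrite divr_gt0 ?pmulrn_lgt0// => /(_ isT).
rewrite -!EFinM -EFinD !lee_fin => aMs.
have -> : M * s = (a / (M *+ 2) * M + (a / (M *+ 2) *+ 4)^-1 * s) * (a *+ 2) - a * a.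
  by field; rewrite !gt_eqF.
rewrite lerBrDr -mulrDr -mulr2n; apply: ler_wpM2r => //.
by rewrite mulrn_wge0// ltW.
Qed.

Lemma normal_pdf_gt0 (R : realType) (m x : R) : 0 < normal_pdf m 1 x.
Proof.
rewrite normal_pdfE ?oner_eq0// mulr_gt0 ?expR_gt0//.
by rewrite normal_peak_gt0// oner_eq0.
Qed.

(** Completing the square: the squared density at [a] over the density at [b] is [exp ((a - b) ^ 2)]
    times a normal density centred at [2 a - b]. That constant is therefore the second moment of the
    likelihood ratio. *)
Lemma sqr_normal_pdf (R : realType) (a b x : R) :
  normal_pdf a 1 x ^+ 2 =
  expR ((a - b) ^+ 2) * normal_pdf (a *+ 2 - b) 1 x * normal_pdf b 1 x.
Proof.
rewrite !normal_pdfE ?oner_eq0// /normal_fun.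
set p := normal_peak _.
transitivity (p ^+ 2 * (expR (- (x - a) ^+ 2 / (1 ^+ 2 *+ 2)) *
  expR (- (x - a) ^+ 2 / (1 ^+ 2 *+ 2)))); first by ring.
rewrite -expRD.
transitivity (p ^+ 2 * (expR ((a - b) ^+ 2) *
  expR (- (x - (a *+ 2 - b)) ^+ 2 / (1 ^+ 2 *+ 2)) *
  expR (- (x - b) ^+ 2 / (1 ^+ 2 *+ 2)))); last by ring.
by rewrite -!expRD; congr (_ * expR _); field.
Qed.

(** This is Cauchy-Schwarz for [f sqrt q] and [p / sqrt q]. The function [r] is [p ^ 2 / q]
    normalized to integral 1, so the second factor contributes [M]. *)
Lemma l2_dom_density d (T : measurableType d) (R : realType)
    (lambda nu mu : {measure set T -> \bar R}) (M : R) (p q r : T -> R) :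
  0 < M ->
  measurable_fun setT p -> measurable_fun setT q -> measurable_fun setT r ->
  (forall x, 0 <= p x) -> (forall x, 0 < q x) -> (forall x, 0 <= r x) ->
  (forall A, measurable A -> nu A = \int[lambda]_(x in A) (p x)%:E)%E ->
  (forall A, measurable A -> mu A = \int[lambda]_(x in A) (q x)%:E)%E ->
  (\int[lambda]_x (r x)%:E = 1)%E ->
  (forall x, p x ^+ 2 = M * r x * q x) ->
  l2_dom M nu mu.
Proof.
move=> M0 mp mq mr p0 q0 r0 nup muq ir1 p2 f mf f0.
have q0' x : 0 <= q x by exact: ltW.
have mE g : measurable_fun setT g -> measurable_fun setT (fun x : T => (g x)%:E).
  by move=> mg; exact/measurable_EFinP.
have mff : measurable_fun setT (fun x => f x * f x)%E by exact: emeasurable_funM.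
have ff0 x : (0 <= f x * f x)%E by rewrite mule_ge0.
rewrite (ge0_integral_density mp p0 nup mf f0).
rewrite (ge0_integral_density mq q0' muq mff ff0).
have mfp : measurable_fun setT (fun x => f x * (p x)%:E)%E.
  by apply: emeasurable_funM => //; exact: mE.
have mffq : measurable_fun setT (fun x => f x * f x * (q x)%:E)%E.
  by apply: emeasurable_funM => //; exact: mE.
have fp0 x : (0 <= f x * (p x)%:E)%E by rewrite mule_ge0 ?lee_fin.
have ffq0 x : (0 <= f x * f x * (q x)%:E)%E by rewrite mule_ge0 ?lee_fin.
apply: sqr_le_of_amgm => //; [exact: integral_ge0|exact: integral_ge0|].
(* [f p <= l p^2 / q + f^2 q / (4 l)] pointwise, and [p^2 / q = M r] *)
move=> l l0.
have l40 : (0 <= ((l *+ 4)^-1)%:E)%E.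
  by rewrite lee_fin invr_ge0 mulrn_wge0// ltW.
have lM0 : (0 <= (l * M)%:E)%E by rewrite lee_fin mulr_ge0// ltW.
rewrite -[X in (X + _)%E]mule1 -ir1.
rewrite -ge0_integralZl//; [|exact: mE|by move=> x _; rewrite lee_fin].
rewrite -ge0_integralZl//.
have mlr : measurable_fun setT (fun x => (l * M)%:E * (r x)%:E)%E.
  by apply: emeasurable_funM => //; exact: mE.
have mlffq : measurable_fun setT
  (fun x => ((l *+ 4)^-1)%:E * (f x * f x * (q x)%:E))%E.
  exact: emeasurable_funM.
rewrite -ge0_integralD//; last 2 first.
- by move=> x _; rewrite mule_ge0 ?lee_fin.
- by move=> x _; rewrite mule_ge0.
apply: ge0_le_integral => //.
- exact: emeasurable_funD.
(* Where [f] is infinite, so is the right side, because [q > 0]. *)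
move=> x _; have := f0 x.
case: (f x) => [y _|_|//]; last first.
  have qy : (+oo * (q x)%:E = +oo)%E by rewrite gt0_mulye ?lte_fin.
  rewrite mulyy qy gt0_muley ?addey ?leey// lte_fin.
  by rewrite invr_gt0 pmulrn_lgt0.
rewrite -!EFinM -EFinD lee_fin -subr_ge0.
(* Multiplied by [4 l q], the difference of the two sides is the square [(2 l p - y q) ^ 2]. *)
have l4q : 0 < l *+ 4 * q x by rewrite mulr_gt0 ?pmulrn_lgt0.
rewrite -(pmulr_lge0 _ l4q).
have -> : (l * M * r x + (l *+ 4)^-1 * (y * y * q x) - y * p x) * (l *+ 4 * q x) =
    (l *+ 2) ^+ 2 * (M * r x * q x) - l *+ 4 * p x * q x * y + (y * q x) ^+ 2.
  by field; rewrite gt_eqF.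
rewrite -p2 (_ : _ + _ = (l *+ 2 * p x - y * q x) ^+ 2) ?sqr_ge0//.
by ring.
Qed.

Lemma l2_dom_normal (R : realType) (a b : R) :
  l2_dom (expR ((a - b) ^+ 2)) (normal_prob a (1 : R)) (normal_prob b (1 : R)).
Proof.
apply: (@l2_dom_density _ _ _ lebesgue_measure _ _ _ (normal_pdf a 1)
  (normal_pdf b 1) (normal_pdf (a *+ 2 - b) 1)).
- exact: expR_gt0.
- exact: measurable_normal_pdf.
- exact: measurable_normal_pdf.
- exact: measurable_normal_pdf.
- exact: normal_pdf_ge0.
- exact: normal_pdf_gt0.
- exact: normal_pdf_ge0.
- by [].
- by [].
- exact: integral_normal_pdf.
- exact: sqr_normal_pdf.
Qed.

(** The first comparison is applied to the inner integral of [f], then the second one under the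
    outer integral. *)
Lemma l2_dom_prod d1 d2 (T1 : measurableType d1) (T2 : measurableType d2)
    (R : realType) (M1 M2 : R) (nu1 mu1 : probability T1 R)
    (nu2 mu2 : probability T2 R) :
  0 <= M1 -> 0 <= M2 ->
  l2_dom M1 nu1 mu1 -> l2_dom M2 nu2 mu2 ->
  l2_dom (M1 * M2) (nu1 \x nu2)%E (mu1 \x mu2)%E.
Proof.
move=> M10 M20 dom1 dom2 f mf f0.
have mff : measurable_fun setT (fun x => f x * f x)%E by exact: emeasurable_funM.
have ff0 x : (0 <= f x * f x)%E by rewrite mule_ge0.
rewrite !fubini_tonelli1//.
have mF : measurable_fun setT (fubini_F nu2 f).
  exact: measurable_fun_fubini_tonelli_F.
have mFF : measurable_fun setT (fubini_F mu2 (fun x => f x * f x)%E).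
  exact: measurable_fun_fubini_tonelli_F.
have F0 x : (0 <= fubini_F nu2 f x)%E by apply: integral_ge0.
apply: (le_trans (dom1 _ mF F0)).
rewrite EFinM -muleA; apply: lee_wpmul2l; first by rewrite lee_fin.
rewrite -ge0_integralZl//; [|by move=> x _; apply: integral_ge0].
apply: ge0_le_integral; [by []| | | |].
- by move=> x _; rewrite mule_ge0.
- exact: emeasurable_funM.
- exact: emeasurable_funM.
by move=> x _; apply: dom2 => //; apply: measurableT_comp => //.
Qed.

Lemma l2_dom_distribution d d' (T : measurableType d) (T' : measurableType d')
    (R : realType) (M : R) (nu mu : probability T R) (X : {mfun T >-> T'}) :
  l2_dom M nu mu -> l2_dom M (distribution nu X) (distribution mu X).
Proof.
move=> dom f mf f0.
have mfX : measurable_fun setT (f \o X) by exact: measurableT_comp.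
rewrite (@ge0_integral_distribution _ _ _ _ _ nu X f mf f0).
rewrite (@ge0_integral_distribution _ _ _ _ _ mu X (fun y => f y * f y)%E).
- exact: (dom _ mfX (fun x => f0 _)).
- exact: emeasurable_funM.
- by move=> x; rewrite mule_ge0.
Qed.

(** For [f] the indicator of [B] the comparison reads [nu B ^ 2 <= M * mu B], and
    [sqrt (M b) <= b + M / 4] by AM-GM. *)
Lemma l2_dom_probability d (T : measurableType d) (R : realType) (M : R)
    (nu mu : probability T R) (B : set T) :
  measurable B -> 0 <= M -> l2_dom M nu mu ->
  fine (nu B) <= fine (mu B) + M / 4.
Proof.
move=> mB M0 dom.
have mB1 : measurable_fun setT (fun x => (\1_B x)%:E : \bar R).
  by apply: measurableT_comp => //; exact: measurable_indic.
have sqr1 x : ((\1_B x)%:E * (\1_B x)%:E = (\1_B x)%:E :> \bar R)%E.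
  by rewrite -EFinM indicE; case: (_ \in _); rewrite ?mulr1 ?mulr0.
have B10 x : (0 <= (\1_B x)%:E :> \bar R)%E by rewrite lee_fin.
have : (nu B * nu B <= M%:E * mu B)%E.
  have := dom _ mB1 B10; under [X in (_ <= _ * X)%E]eq_integral do rewrite sqr1.
  by rewrite !integral_indic// !setIT.
have nufin : nu B \is a fin_num by exact: fin_num_measure.
have mufin : mu B \is a fin_num by exact: fin_num_measure.
have : (0 <= mu B)%E by exact: measure_ge0.
move: nufin mufin; case: (nu B) (mu B) => [a| |] [b| |]// _ _.
rewrite -!EFinM !lee_fin /= => b0 ab.
rewrite leNgt; apply/negP => ba.
have : (b + M / 4) * (b + M / 4) < a * a by apply: ltr_pM => //; lra.
have := sqr_ge0 (b - M / 4).
rewrite (_ : _ ^+ 2 = (b + M / 4) * (b + M / 4) - M * b); first by lra.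
by field.
Qed.

(** * Finite product measures on tuples *)

Definition tuple_cons (T : Type) n (x : T * n.-tuple T) : n.+1.-tuple T :=
  [tuple of x.1 :: x.2].

Lemma measurable_tuple_cons d (T : measurableType d) n :
  measurable_fun [set: T * n.-tuple T] (@tuple_cons T n).
Proof. exact: measurable_cons. Qed.

HB.instance Definition _ d (T : measurableType d) n :=
  isMeasurableFun.Build _ _ _ _ (@tuple_cons T n) (@measurable_tuple_cons d T n).

(** The factors are indexed by [nat], so that the recursion passes to the tail by shifting the
    family, without casts between ordinals. *)
Fixpoint iprod d (T : measurableType d) (R : realType) n
    (mu : nat -> probability T R) : probability (n.-tuple T) R :=
  if n is n'.+1 then
    distribution (mu 0%N \x iprod n' (fun k => mu k.+1))%E (@tuple_cons T n')
  else dirac [tuple].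

Lemma measurable_tuple_rect d (T : measurableType d) n (A : 'I_n -> set T) :
  (forall i, measurable (A i)) ->
  measurable [set x : n.-tuple T | forall i, A i (tnth x i)].
Proof.
move=> mA.
rewrite (_ : mkset _ = \bigcap_(i in setT) ((fun x => tnth x i) @^-1` A i)).
  apply: fin_bigcap_measurable => // i _; rewrite -[X in measurable X]setTI.
  exact: measurable_tnth.
by apply/seteqP; split => x /= Ax i => [_|]; exact: Ax.
Qed.

(** Both [is_gaussian_Ip] and [is_iid_law] are instances of this formula. In the induction, the
    preimage of a rectangle under [tuple_cons] is its first side times the rectangle of the
    others. *)
Lemma iprod_rect d (T : measurableType d) (R : realType) n
    (mu : nat -> probability T R) (A : 'I_n -> set T) :
  (forall i, measurable (A i)) ->
  iprod n mu [set x | forall i, A i (tnth x i)] =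
  (\prod_(i < n) fine (mu i (A i)))%:E.
Proof.
elim: n mu A => [|n IH] mu A mA /=.
  rewrite big_ord0 diracE mem_set//= => -[].
  by [].
rewrite /distribution /pushforward.
rewrite (_ : _ @^-1` _ = A ord0 `*`
    [set x | forall i, A (lift ord0 i) (tnth x i)]); last first.
  apply/seteqP; split => -[x y] /=.
    by move=> Axy; split=> [|i]; [exact: (Axy ord0)|
      have := Axy (lift ord0 i); rewrite tnthS].
  move=> [Ax Ay] i; case: (unliftP ord0 i) => [j ->|->//].
  by rewrite tnthS.
pose A' i := A (lift ord0 i).
transitivity (mu 0%N (A ord0) * iprod n (fun k => mu k.+1)
    [set x | forall i, A' i (tnth x i)])%E.
  apply: product_measure1E; first exact: mA.
  exact: (measurable_tuple_rect (fun i => mA (lift ord0 i))).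
rewrite IH; last by move=> i; exact: mA.
rewrite big_ord_recl EFinM; congr (_ * _)%E.
by rewrite fineK// fin_num_measure.
Qed.

Lemma l2_dom_iprod d (T : measurableType d) (R : realType) n (M : nat -> R)
    (nu mu : nat -> probability T R) :
  (forall k, 0 <= M k) -> (forall k, l2_dom (M k) (nu k) (mu k)) ->
  l2_dom (\prod_(k < n) M k) (iprod n nu) (iprod n mu).
Proof.
elim: n M nu mu => [|n IH] M nu mu M0 dom.
  move=> f mf f0; rewrite big_ord0 mul1e /= !integral_dirac// ?diracT ?mul1e//.
  exact: emeasurable_funM.
rewrite big_ord_recl; apply: l2_dom_distribution.
apply: l2_dom_prod => //; first exact: prodr_ge0.
exact: (IH (fun k => M k.+1) (fun k => nu k.+1) (fun k => mu k.+1)).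
Qed.

(** * Gaussian laws and their i.i.d. samples *)

(* [normal_prob] lives on the copy [measurableTypeR R] of [R], which has another
   display than [R]; it is transported along the identity. *)
Definition real_copy (R : realType) (x : measurableTypeR R) : R := x.

Lemma measurable_real_copy (R : realType) :
  measurable_fun [set: measurableTypeR R] (@real_copy R).
Proof. by move=> _ A mA; rewrite setTI. Qed.

HB.instance Definition _ (R : realType) :=
  isMeasurableFun.Build _ _ _ _ (@real_copy R) (@measurable_real_copy R).

Definition normal1 (R : realType) (m : R) : probability R R :=
  distribution (normal_prob m (1 : R)) (@real_copy R).

(** The default 0 of [nth] concerns only indices from [p] on, which [iprod p] never reads. *)
Definition gauss (R : realType) p (theta : p.-tuple R) :
    probability (p.-tuple R) R :=
  iprod p (fun k => normal1 (nth 0 theta k)).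

Lemma is_gaussian_gauss (R : realType) p (theta : p.-tuple R) :
  is_gaussian_Ip theta (gauss theta).
Proof.
move=> A mA; rewrite /gauss (iprod_rect _ mA); congr EFin.
by apply: eq_bigr => i _; rewrite (tnth_nth 0).
Qed.

Lemma is_iid_iprod (R : realType) p n (P : probability (p.-tuple R) R) :
  is_iid_law P (iprod n (fun=> P)).
Proof. by move=> B mB; rewrite iprod_rect. Qed.

(** * Translates of a law and Wasserstein distance *)

Definition tuple_shift (R : realType) p (v x : p.-tuple R) : p.-tuple R :=
  [tuple tnth x i + tnth v i | i < p].

Lemma measurable_tuple_shift (R : realType) p (v : p.-tuple R) :
  measurable_fun setT (tuple_shift v).
Proof.
apply/measurable_fun_tnthP => i.
rewrite (_ : _ \o _ = fun x => tnth x i + tnth v i); last first.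
  by apply/funext => x /=; rewrite tnth_mktuple.
by apply: measurable_funD => //; exact: measurable_tnth.
Qed.

HB.instance Definition _ (R : realType) p (v : p.-tuple R) :=
  isMeasurableFun.Build _ _ _ _ (tuple_shift v) (measurable_tuple_shift v).

(** The Gaussian law at the shifted mean is realized as a pushforward, so it comes coupled with
    [gauss theta]. Only rectangles have to be checked, coordinate by coordinate. *)
Lemma is_gaussian_shift (R : realType) p (theta v : p.-tuple R) :
  is_gaussian_Ip (tuple_shift v theta) (distribution (gauss theta) (tuple_shift v)).
Proof.
move=> A mA.
pose B i := (fun y => y + tnth v i) @^-1` A i.
have mB i : measurable (B i).
  by rewrite -[X in measurable X]setTI; exact: measurable_funD.
transitivity (gauss theta [set x | forall i, B i (tnth x i)]).
  congr (gauss theta _); apply/seteqP.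
  by split => x /= Ax i; have := Ax i; rewrite tnth_mktuple.
rewrite (is_gaussian_gauss theta mB); congr EFin; apply: eq_bigr => i _.
by rewrite tnth_mktuple; congr fine; apply/esym/normal_prob_shift.
Qed.

Lemma measurable_l2dist d (T : measurableType d) (R : realType) p
    (f g : T -> p.-tuple R) :
  measurable_fun setT f -> measurable_fun setT g ->
  measurable_fun setT (fun x => l2dist (f x) (g x)).
Proof.
move=> mf mg.
apply: (@measurableT_comp _ _ _ _ _ _ (@Num.sqrt R)).
  by apply: continuous_measurable_fun; exact: sqrt_continuous.
apply: measurable_sum => i; apply: measurable_funX.
by apply: measurable_funB; exact: (measurableT_comp (measurable_tnth i)).
Qed.

(** The joint law of [f] and [g] under [mu] is a coupling of [P] and [Q]. *)
Lemma wasserstein1_le_coupling d (T : measurableType d) (R : realType) p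
    (mu : probability T R) (P Q : probability (p.-tuple R) R)
    (f g : T -> p.-tuple R) :
  measurable_fun setT f -> measurable_fun setT g ->
  (forall A, measurable A -> P A = mu (f @^-1` A)) ->
  (forall A, measurable A -> Q A = mu (g @^-1` A)) ->
  (wasserstein1 P Q <= \int[mu]_x (l2dist (f x) (g x))%:E)%E.
Proof.
move=> mf mg Pf Qg; apply: ereal_inf_lbound.
have mfg : measurable_fun setT (fun x => (f x, g x)).
  exact: measurable_fun_pair.
pose fg : {mfun T >-> (p.-tuple R * p.-tuple R)%type} :=
  HB.pack (fun x => (f x, g x)) (isMeasurableFun.Build _ _ _ _ _ mfg).
exists (distribution mu fg); split; first split.
- move=> A mA; rewrite Pf// /distribution /pushforward; congr (mu _).
  by apply/seteqP; split => x /=; [case|].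
- move=> A mA; rewrite Qg// /distribution /pushforward; congr (mu _).
  by apply/seteqP; split => x /=; [case|].
rewrite ge0_integral_distribution//.
- by apply/measurable_EFinP; exact: measurable_l2dist.
- by move=> z; rewrite lee_fin sqrtr_ge0.
Qed.

(** Couple [x] with [x + v]: the transport distance is constantly the norm of [v]. *)
Lemma wasserstein1_shift (R : realType) p (v : p.-tuple R)
    (P : probability (p.-tuple R) R) :
  (wasserstein1 (distribution P (tuple_shift v)) P <=
   (Num.sqrt (\sum_(i < p) tnth v i ^+ 2))%:E)%E.
Proof.
have := @wasserstein1_le_coupling _ _ _ _ P (distribution P (tuple_shift v)) P
  _ _ (measurable_tuple_shift v) (@measurable_id _ _ _) (fun _ _ => erefl)
  (fun _ _ => erefl).
under eq_integral.
  move=> x _.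
  rewrite (_ : l2dist _ _ = Num.sqrt (\sum_(i < p) tnth v i ^+ 2)); last first.
    congr Num.sqrt; apply: eq_bigr => i _; rewrite tnth_mktuple/=.
    by rewrite addrAC subrr add0r.
  over.
by rewrite integral_cst// [X in (_ * X)%E]probability_setT mule1.
Qed.

Lemma wasserstein1_refl (R : realType) p (P : probability (p.-tuple R) R) :
  (wasserstein1 P P <= 0)%E.
Proof.
have := @wasserstein1_le_coupling _ _ _ _ P P P _ _ (@measurable_id _ _ _)
  (@measurable_id _ _ _)
  (fun _ _ => erefl) (fun _ _ => erefl).
rewrite integral0_eq// => x _; rewrite /l2dist big1 ?sqrtr0// => i _.
by rewrite subrr expr0n.
Qed.

(** * Comparison of Gaussian samples, and a reverse Markov inequality *)

(** The one-dimensional constants multiply over the coordinates, then over the [n] observations, so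
    the exponents add up. *)
Lemma l2_dom_gauss (R : realType) n p (a b : p.-tuple R) :
  l2_dom (expR (n%:R * \sum_(i < p) (tnth a i - tnth b i) ^+ 2))
    (iprod n (fun=> gauss a)) (iprod n (fun=> gauss b)).
Proof.
pose M (k : nat) : R := expR ((nth 0 a k - nth 0 b k) ^+ 2).
have dom1 : l2_dom (\prod_(k < p) M k) (gauss a) (gauss b).
  apply: l2_dom_iprod => k; first exact: expR_ge0.
  exact/l2_dom_distribution/l2_dom_normal.
have -> : expR (n%:R * \sum_(i < p) (tnth a i - tnth b i) ^+ 2) =
    \prod_(j < n) \prod_(k < p) M k.
  rewrite prodr_const card_ord expRM_natl -expR_sum; congr (expR _ ^+ _).
  by apply: eq_bigr => i _; rewrite !(tnth_nth 0).
apply: (@l2_dom_iprod _ _ _ n (fun=> \prod_(k < p) M k)) => // _.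
by apply: prodr_ge0 => k _; exact: expR_ge0.
Qed.

(** The number of events [A i] that occur is at most [p] on [E] and at most [K] off [E]; integrate
    this bound. *)
Lemma sum_probability_le d (T : measurableType d) (R : realType)
    (P : probability T R) p (A : 'I_p -> set T) (E : set T) (K : R) :
  (forall i, measurable (A i)) -> measurable E -> 0 <= K ->
  (forall x, ~ E x -> \sum_(i < p) \1_(A i) x <= K) ->
  \sum_(i < p) fine (P (A i)) <= p%:R * fine (P E) + K.
Proof.
move=> mA mE K0 AEK.
have m1 (B : set T) : measurable B -> measurable_fun setT (fun x : T => (\1_B x)%:E : \bar R).
  by move=> mB; apply: measurableT_comp => //; exact: measurable_indic.
have fin (B : set T) : measurable B -> (fine (P B))%:E = P B.
  by move=> mB; rewrite fineK// fin_num_measure.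
have int1 (B : set T) : measurable B -> (\int[P]_x (\1_B x)%:E = P B)%E.
  by move=> mB; rewrite integral_indic// setIT.
rewrite -lee_fin EFinD EFinM -sumEFin fin//.
under eq_bigr do rewrite fin// -int1//.
rewrite -ge0_integral_sum//; last by move=> i; exact: m1.
have PT : (\int[P]_x K%:E = K%:E)%E.
  by rewrite integral_cst// [X in (_ * X)%E]probability_setT mule1.
rewrite -PT -int1// -ge0_integralZl//; [|exact: m1].
rewrite -ge0_integralD//; last first.
- by apply: emeasurable_funM => //; exact: m1.
apply: ge0_le_integral; [by []| | | |].
- by move=> x _; apply: sume_ge0 => i _; rewrite lee_fin.
- by apply: emeasurable_sum => i; exact: m1.
- apply: emeasurable_funD => //.
  by apply: emeasurable_funM => //; exact: m1.
move=> x _; rewrite sumEFin -EFinM -EFinD lee_fin.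
have [Ex|nEx] := pselect (E x).
  rewrite (indicE _ E) mem_set// mulr1 -[leLHS]addr0 lerD//.
  apply: (@le_trans _ _ (\sum_(i < p) 1)); last by rewrite sumr_const card_ord.
  by apply: ler_sum => i _; rewrite indicE lern1 leq_b1.
by rewrite (indicE _ E) memNset// mulr0 add0r; exact: AEK.
Qed.

Lemma norm_coord_le_l2dist (R : realType) p (x y : p.-tuple R) i :
  `|tnth x i - tnth y i| <= l2dist x y.
Proof.
rewrite -sqrtr_sqr ler_wsqrtr// (bigD1 i)//= lerDl.
by apply: sumr_ge0 => j _; exact: sqr_ge0.
Qed.

Lemma measurable_l2dist_ge d (T : measurableType d) (R : realType) p
    (theta : p.-tuple R) (est : T -> p.-tuple R) (r : R) :
  measurable_fun setT est ->
  measurable [set x | r <= l2dist theta (est x)].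
Proof.
move=> mest; rewrite -[X in measurable X]setTI.
rewrite (_ : mkset _ = (fun x => l2dist theta (est x)) @^-1` `[r, +oo[%classic).
  apply: (measurable_l2dist _ mest) => //.
by apply/seteqP; split => x /=; rewrite in_itv/= andbT.
Qed.

(** * Lower bound at radius [eps]: two centres, one data law *)

Lemma two_point_bound d (T : measurableType d) (R : realType) p (eps : R)
    (Q : probability T R) (est : T -> p.-tuple R) :
  (0 < p)%N -> 0 <= eps -> measurable_fun setT est ->
  exists v : p.-tuple R, Num.sqrt (\sum_(i < p) tnth v i ^+ 2) = eps /\
    1 / 2 <= fine (Q [set x | eps <= l2dist v (est x)]).
Proof.
case: p est => // p est _ eps0 mest.
pose v (s : R) : p.+1.-tuple R := [tuple if i == ord0 then s else 0 | i < p.+1].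
have normv s : Num.sqrt (\sum_(i < p.+1) tnth (v s) i ^+ 2) = `|s|.
  rewrite -sqrtr_sqr big_ord_recl big1 ?addr0 ?tnth_mktuple// => i _.
  by rewrite tnth_mktuple /= expr0n.
pose E s := [set x | eps <= l2dist (v s) (est x)].
have mE s : measurable (E s) by exact: measurable_l2dist_ge.
(* The sign of the first coordinate of the estimate tells which of the centres [eps e_1] and
   [- eps e_1] is at distance at least [eps]. The two events cover the space, so one has probability
   at least 1/2. *)
have EU : setT `<=` E eps `|` E (- eps).
  move=> x _.
  have ge s : `|s - tnth (est x) ord0| <= l2dist (v s) (est x).
    by have := norm_coord_le_l2dist (v s) (est x) ord0; rewrite tnth_mktuple.
  have [x0|x0] := leP 0 (tnth (est x) ord0); [right|left];
    rewrite /E /=; apply: le_trans (ge _).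
    by rewrite -normrN ger0_norm; lra.
  by rewrite ger0_norm; lra.
have : 1 <= fine (Q (E eps)) + fine (Q (E (- eps))).
  rewrite -lee_fin EFinD !fineK ?fin_num_measure//.
  rewrite -(probability_setT Q).
  apply: le_trans (measureU2 _ _ _) => //.
  by apply: le_measure; rewrite ?inE//; apply: measurableU.
have [h _|h h1] := leP (1 / 2) (fine (Q (E eps))).
  by exists (v eps); rewrite normv ger0_norm.
by exists (v (- eps)); rewrite normv normrN ger0_norm//; split => //; rewrite -/(E _); lra.
Qed.

(** * Lower bound at radius [sqrt (p / n)]: the hypercube *)

(** Inverse of [exp (- 1/4) >= 3/4]. With [M = exp (1/4)], the loss [M / 4] in [l2_dom_probability]
    is then at most 1/3. *)
Lemma expR_quarter_le (R : realType) : expR (1 / 4 : R) <= 4 / 3.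
Proof.
have := expR_ge1Dx (- (1 / 4) : R); rewrite expRN.
have e0 := expR_gt0 (1 / 4 : R); have := mulfV (lt0r_neq0 e0).
move: (expR (1 / 4)) e0 => e e0; move: (e^-1) => f ef f34.
have : 0 <= e * (f - 3 / 4) by apply: mulr_ge0; lra.
by rewrite mulrBr ef; lra.
Qed.

(** When coordinate [i] of [theta] is [delta] or [- delta], this event contains every wrong guess of
    its sign. Stated as a distance, it contributes [delta ^ 2] directly to the squared error. *)
Definition coord_far (R : realType) (T : Type) p (delta : R) (i : 'I_p)
    (est : T -> p.-tuple R) (theta : p.-tuple R) : set T :=
  [set x | delta ^+ 2 <= (tnth theta i - tnth (est x) i) ^+ 2].

Lemma measurable_coord_far d (T : measurableType d) (R : realType) p (delta : R)
    (i : 'I_p) (est : T -> p.-tuple R) (theta : p.-tuple R) :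
  measurable_fun setT est -> measurable (coord_far delta i est theta).
Proof.
move=> mest; rewrite -[X in measurable X]setTI.
rewrite (_ : coord_far _ _ _ _ =
    (fun x => (tnth theta i - tnth (est x) i) ^+ 2) @^-1`
    `[delta ^+ 2, +oo[%classic); last first.
  by apply/seteqP; split => x /=; rewrite in_itv/= andbT.
have mt : measurable_fun setT (fun x => (tnth theta i - tnth (est x) i) ^+ 2).
  apply: measurable_funX; apply: measurable_funB => //.
  exact: (measurableT_comp (measurable_tnth i)).
exact: mt.
Qed.

(** A two-point argument: an estimate that is not far from [b] at [i] is far from [a]. Passing from
    the sample law at [b] to the one at [a] costs at most 1/3, which leaves 2/3 for the sum of the
    two errors. *)
Lemma hypercube_pair (R : realType) n p (a b : p.-tuple R) (i : 'I_p) (delta : R)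
    (est : n.-tuple (p.-tuple R) -> p.-tuple R) :
  n%:R * (delta *+ 2) ^+ 2 = 1 / 4 ->
  measurable_fun setT est ->
  (tnth a i) ^+ 2 = delta ^+ 2 -> tnth b i = - tnth a i ->
  (forall j, j != i -> tnth b j = tnth a j) ->
  2 / 3 <= fine (iprod n (fun=> gauss a) (coord_far delta i est a)) +
           fine (iprod n (fun=> gauss b) (coord_far delta i est b)).
Proof.
move=> nd mest a2 bi bj.
pose E := coord_far delta i est.
have mE t : measurable (E t) by exact: measurable_coord_far.
rewrite -!/(E _).
have M1 : n%:R * \sum_(j < p) (tnth b j - tnth a j) ^+ 2 = 1 / 4.
  rewrite (bigD1 i)//= big1 ?addr0; last first.
    by move=> j ji; rewrite bj// subrr expr0n.
  rewrite bi -nd; congr (_ * _).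
  transitivity (4 * tnth a i ^+ 2); first by ring.
  by rewrite a2; ring.
have := @l2_dom_gauss R n p b a; rewrite M1.
move: (iprod n (fun=> gauss a)) (iprod n (fun=> gauss b)) => Qa Qb dom.
have mEC : measurable (~` E b) by exact: measurableC.
have h := l2_dom_probability mEC (expR_ge0 _) dom.
have EC : fine (Qb (~` E b)) = 1 - fine (Qb (E b)).
  by rewrite probability_setC// fineB ?fin_num_measure.
(* With [u] the coordinate of [a] and [y] that of the estimate, [(- u - y) ^ 2 < u ^ 2] forces
   [2 u y < - y ^ 2 <= 0], hence [(u - y) ^ 2 >= u ^ 2]. *)
have sub : fine (Qa (~` E b)) <= fine (Qa (E a)).
  apply: fine_le; rewrite ?fin_num_measure//.
  apply: le_measure; rewrite ?inE// => x; rewrite /E /coord_far /= => /negP.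
  rewrite -ltNge bi -a2; move: (tnth a i) (tnth (est x) i) => u y uy.
  by have := sqr_ge0 y; lra.
have := expR_quarter_le R; lra.
Qed.

(** Assouad's argument: the expected number of far coordinates, summed over the vertices, is bounded
    below by pairing vertices along each edge direction, and above by [sum_probability_le]. *)
Lemma hypercube_bound (R : realType) n p
    (est : n.-tuple (p.-tuple R) -> p.-tuple R) :
  (0 < n)%N -> (0 < p)%N -> measurable_fun setT est ->
  exists theta : p.-tuple R,
    1 / 6 <= fine (iprod n (fun=> gauss theta)
      [set x | 1 / 10 * Num.sqrt (p%:R / n%:R) <= l2dist theta (est x)]).
Proof.
move=> n0 p0 mest.
have n0' : 0 < n%:R :> R by rewrite ltr0n.
have p0' : 0 < p%:R :> R by rewrite ltr0n.
pose delta : R := (Num.sqrt n%:R *+ 4)^-1.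
have d2 : delta ^+ 2 = (n%:R * 16)^-1.
  rewrite exprVn; congr _^-1.
  transitivity (Num.sqrt n%:R ^+ 2 * 16 : R); first by ring.
  by rewrite sqr_sqrtr// ltW.
have nd : n%:R * (delta *+ 2) ^+ 2 = 1 / 4.
  transitivity (n%:R * 4 * delta ^+ 2); first by ring.
  by rewrite d2; field; rewrite gt_eqF.
pose theta (s : {ffun 'I_p -> bool}) : p.-tuple R :=
  [tuple if s i then delta else - delta | i < p].
pose flip i (s : {ffun 'I_p -> bool}) : {ffun 'I_p -> bool} :=
  [ffun j => if j == i then ~~ s j else s j].
have flipK i : involutive (flip i).
  by move=> s; apply/ffunP => j; rewrite !ffunE; case: eqP => //; rewrite negbK.
pose Q s := iprod n (fun=> gauss (theta s)).
pose E s := [set x | 1 / 10 * Num.sqrt (p%:R / n%:R) <= l2dist (theta s) (est x)].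
pose A s i := coord_far delta i est (theta s).
have mE s : measurable (E s) by exact: measurable_l2dist_ge.
have mA s i : measurable (A s i) by exact: measurable_coord_far.
(* Off [E s] the squared error is below [p / (100 n)], while each far coordinate costs
   [delta ^ 2 = 1 / (16 n)]; hence at most [16 p / 100 = 4 p / 25] coordinates are far. *)
have AE s : \sum_(i < p) fine (Q s (A s i)) <=
    p%:R * fine (Q s (E s)) + p%:R * (4 / 25).
  have K0 : 0 <= p%:R * (4 / 25) :> R by lra.
  apply: (@sum_probability_le _ _ _ (Q s) p (A s) (E s) _ (mA s) (mE s) K0).
  move=> x /negP; rewrite -ltNge => xE.
  have dist2 : l2dist (theta s) (est x) ^+ 2 < p%:R / n%:R / 100.
    have -> : p%:R / n%:R / 100 = (1 / 10 * Num.sqrt (p%:R / n%:R)) ^+ 2 :> R.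
      by rewrite exprMn sqr_sqrtr ?divr_ge0// ?ltW//; field; rewrite gt_eqF.
    have dist0 : 0 <= l2dist (theta s) (est x) by exact: sqrtr_ge0.
    by rewrite ltr_sqr// nnegrE ltW// (le_lt_trans dist0).
  have : delta ^+ 2 * \sum_(i < p) \1_(A s i) x <= l2dist (theta s) (est x) ^+ 2.
    rewrite sqr_sqrtr ?sumr_ge0// => [|i _]; last exact: sqr_ge0.
    rewrite mulr_sumr; apply: ler_sum => i _; rewrite indicE.
    case: (boolP (x \in A s i)) => [|_]; first by rewrite inE mulr1.
    by rewrite mulr0 sqr_ge0.
  move=> /le_lt_trans /(_ dist2) /ltW.
  rewrite d2 mulrC ler_pdivrMr ?mulr_gt0//.
  by rewrite (_ : _ * (n%:R * 16) = p%:R * (4 / 25))//; field; rewrite gt_eqF.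
have pair s i : 2 / 3 <= fine (Q s (A s i)) + fine (Q (flip i s) (A (flip i s) i)).
  apply: (@hypercube_pair _ _ _ (theta s) (theta (flip i s)) i delta est) => //.
  - by rewrite tnth_mktuple; case: ifP; rewrite ?sqrrN.
  - by rewrite !tnth_mktuple ffunE eqxx; case: (s i); rewrite ?opprK.
  - by move=> j ji; rewrite !tnth_mktuple ffunE (negbTE ji).
apply: contrapT => /forallNP noE.
have Elt s : fine (Q s (E s)) < 1 / 6.
  by rewrite ltNge; apply/negP; exact: noE (theta s).
pose N : R := #|{ffun 'I_p -> bool}|%:R.
have N0 : 0 < N by rewrite ltr0n; apply/card_gt0P; exists [ffun=> true].
have sumN c : \sum_(s : {ffun 'I_p -> bool}) c = N * c.
  by rewrite sumr_const /N mulr_natl.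
(* If every [E s] has probability below 1/6, the average count is at most
   [p (1/6 + 4/25) = 49 p / 150], short of the lower bound [p / 3 = 50 p / 150]. *)
have up : \sum_s \sum_(i < p) fine (Q s (A s i)) <= N * (p%:R * (49 / 150)).
  rewrite -sumN; apply: ler_sum => s _.
  apply: (le_trans (AE s)); have := Elt s; nra.
have lo : N * (p%:R * (1 / 3)) <= \sum_s \sum_(i < p) fine (Q s (A s i)).
  rewrite exchange_big /=.
  rewrite (_ : N * _ = \sum_(i < p) (N * (1 / 3))); last first.
    by rewrite sumr_const card_ord -[RHS]mulr_natl; ring.
  (* Flipping coordinate [i] permutes the vertices, so twice the sum over [s] is a sum over pairs,
     each at least 2/3. *)
  apply: ler_sum => i _.
  suff : \sum_(s : {ffun 'I_p -> bool}) (2 / 3) <=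
      (\sum_s fine (Q s (A s i))) *+ 2.
    by rewrite sumN; lra.
  rewrite mulr2n [X in _ <= _ + X](reindex_inj (inv_inj (flipK i))) -big_split /=.
  by apply: ler_sum => s _.
have : 0 < N * p%:R by rewrite mulr_gt0.
nra.
Qed.

(** * Combination of the two bounds *)

Theorem theorem5 (R : realType) :
  exists C c : R, 0 < C /\ 0 < c /\
  forall (n p : nat) (eps : R), (0 < n)%N -> (0 < p)%N -> 0 <= eps ->
  forall est : n.-tuple (p.-tuple R) -> p.-tuple R,
    measurable_fun setT est ->
    (c%:E <= ereal_sup
      [set y | exists (theta : p.-tuple R)
                      (G P : probability (p.-tuple R) R)
                      (Q : probability (n.-tuple (p.-tuple R)) R),
         [/\ is_gaussian_Ip theta G,
             (wasserstein1 G P <= eps%:E)%E,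
             is_iid_law P Q &
             y = Q [set x | (C * Num.max (Num.sqrt (p%:R / n%:R)) eps
                            <= l2dist theta (est x))%R]]])%E.
Proof.
(* These are the constants of [hypercube_bound]; [two_point_bound] has room to spare, with radius
   [eps] and probability 1/2. *)
exists (1 / 10), (1 / 6); split; [by lra|split; [by lra|]].
move=> n p eps n0 p0 eps0 est mest.
have mE theta r := @measurable_l2dist_ge _ _ _ _ theta est r mest.
have [eps_le|eps_gt] := leP eps (Num.sqrt (p%:R / n%:R)).
- have [theta le6] := hypercube_bound n0 p0 mest.
  apply: le_trans (ereal_sup_ubound _); last first.
    exists theta, (gauss theta), (gauss theta), (iprod n (fun=> gauss theta)).
    split; [exact: is_gaussian_gauss| |exact: is_iid_iprod|reflexivity].
    by apply: (le_trans (wasserstein1_refl _)); rewrite lee_fin.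
  by rewrite -[leRHS]fineK ?lee_fin// fin_num_measure.
- pose z : p.-tuple R := [tuple 0 | i < p].
  have [v [normv le2]] := two_point_bound (iprod n (fun=> gauss z)) p0 eps0 mest.
  have zv : tuple_shift v z = v.
    by apply: eq_from_tnth => i; rewrite !tnth_mktuple add0r.
  apply: le_trans (ereal_sup_ubound _); last first.
    (* The data law [P] is the centred Gaussian, fixed before [v] is chosen; the true law is its
       translate by [v], within [eps] of it. *)
    exists v, (distribution (gauss z) (tuple_shift v)), (gauss z).
    exists (iprod n (fun=> gauss z)); split; [| |exact: is_iid_iprod|reflexivity].
      by have := is_gaussian_shift z v; rewrite zv.
    by apply: (le_trans (wasserstein1_shift _ _)); rewrite normv.
  apply: (@le_trans _ _ (1 / 2)%:E); first by rewrite lee_fin; lra.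
  rewrite -[leRHS]fineK ?lee_fin ?fin_num_measure//; apply: (le_trans le2).
  apply: fine_le; rewrite ?fin_num_measure//.
  apply: le_measure; rewrite ?inE// => x /=; apply: le_trans.
  by lra.
Qed.
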